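(* Let $X$ be a reflexive real Banach space, $Y$ a real Banach space, $\Omega$ a measure space, $Z:=L^2(\Omega)$, and $e:Y\to Z$ a linear continuous dense embedding. Let $f:X\to\mathbb{R}$ and $g:X\to Y$ be such that $f$ and $x\mapsto\|g_+(x)\|_Z$ are weakly lower semicontinuous, $g$ is convex (with respect to the order of $Y$), $f$ is strongly convex, and the feasible set $\{x\in X: g(x)\le 0\}$ is nonempty. Let $(x^k)$ be generated by the augmented Lagrangian algorithm described in the context, where in Step 2 the iterate $x^{k+1}$ is chosen such that there is a sequence $\varepsilon_k\downarrow 0$ with $L_{\rho_k}(x^{k+1},w^k)\le L_{\rho_k}(x,w^k)+\varepsilon_k$ for all $x\in X$ and all $k$. Then the problem $\min f(x)$ s.t. $g(x)\le 0$ has a unique solution $\bar x$, and $x^k\to\bar x$ strongly in $X$.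
   Context: The order on $Y$ is induced by $Z$: $y\le 0$ in $Y$ means $e(y)\le 0$ a.e. on $\Omega$; $g$ convex means $g(tx+(1-t)x')\le t g(x)+(1-t)g(x')$ in this order for all $x,x'\in X$, $t\in[0,1]$. For $z\in Z$, $z_+:=\max\{z,0\}$ (pointwise); $g_+(x):=(e(g(x)))_+$, and $\min$ of elements of $Z$ is pointwise. The augmented Lagrangian is $L_\rho(x,\lambda):=f(x)+\frac{\rho}{2}\big\|\big(g(x)+\frac{\lambda}{\rho}\big)_+\big\|_Z^2$ for $x\in X$, $\lambda\in Z$, $\rho>0$. Algorithm: (S.0) Choose $(x^0,\lambda^0)\in X\times Z$, $\rho_0>0$, $w^{\max}\in Z$ with $w^{\max}\ge 0$, $\gamma>1$, $\tau\in(0,1)$; $k=0$. (S.2) Choose $w^k\in Z$ with $0\le w^k\le w^{\max}$ a.e. and compute an approximate minimizer $x^{k+1}$ of $L_{\rho_k}(\cdot,w^k)$. (S.3) Set $\lambda^{k+1}:=(w^k+\rho_k g(x^{k+1}))_+$. If $k=0$ or $\|\min\{-g(x^{k+1}),w^k/\rho_k\}\|_Z\le\tau\|\min\{-g(x^k),w^{k-1}/\rho_{k-1}\}\|_Z$, set $\rho_{k+1}:=\rho_k$; else $\rho_{k+1}:=\gamma\rho_k$. (S.4) $k\leftarrow k+1$, go to (S.2). The algorithm is run without stopping. *)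

(* Defs.v *)
From HB Require Import structures.
From mathcomp Require Import all_boot all_order all_algebra.
From mathcomp Require Import all_classical all_reals all_analysis.
Set Implicit Arguments. Unset Strict Implicit. Unset Printing Implicit Defensive.
Import Order.TTheory GRing.Theory Num.Theory.
Import numFieldNormedType.Exports.
Local Open Scope classical_set_scope.
Local Open Scope ring_scope.

Section FunctionalAnalysis.
Variables (R : realType) (X : normedModType R).

Definition is_linear_fun (phi : X -> R) :=
  forall (a : R) (x y : X), phi (a *: x + y) = a * phi x + phi y.

Definition dual_elt (phi : X -> R) := is_linear_fun phi /\ continuous phi.

Definition dual_norm (phi : X -> R) : R :=
  sup [set r | exists x : X, `|x| <= 1 /\ r = `|phi x|].

(* X is reflexive: the canonical embedding J : X -> X'' is surjective, i.e.
   every bounded linear functional Phi on X' is evaluation at some x. *)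
Definition reflexive_space :=
  forall Phi : (X -> R) -> R,
    (forall (a : R) (phi psi : X -> R), dual_elt phi -> dual_elt psi ->
        Phi (fun x => a * phi x + psi x) = a * Phi phi + Phi psi) ->
    (exists C : R, forall phi, dual_elt phi -> `|Phi phi| <= C * dual_norm phi) ->
    exists x : X, forall phi, dual_elt phi -> Phi phi = phi x.

Definition weakly_open (U : set X) :=
  forall x, U x -> exists (n : nat) (phi : 'I_n -> X -> R),
    (forall i, dual_elt (phi i)) /\
    exists2 delta : R, 0 < delta &
      forall y, (forall i, `|phi i y - phi i x| < delta) -> U y.

Definition weakly_closed (A : set X) := weakly_open (~` A).

Definition weakly_lsc (F : X -> R) :=
  forall c : R, weakly_closed [set x | F x <= c].

Definition strongly_convex (F : X -> R) :=
  exists2 m : R, 0 < m &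
    forall (x x' : X) (t : R), 0 <= t <= 1 ->
      F (t *: x + (1 - t) *: x') <=
        t * F x + (1 - t) * F x' - m / 2 * t * (1 - t) * `|x - x'| ^+ 2.

End FunctionalAnalysis.

Section L2Setting.
Variables (R : realType) (d : measure_display) (T : measurableType d)
  (mu : {measure set T -> \bar R}).

Definition L2norm (h : T -> R) : \bar R := Lnorm mu 2%:E (EFin \o h).

(* h represents an element of Z = L^2(Omega) *)
Definition inZ (h : T -> R) :=
  measurable_fun setT h /\ (L2norm h < +oo)%E.

Definition posp (h : T -> R) : T -> R := fun t => Num.max (h t) 0.
Definition minf (h1 h2 : T -> R) : T -> R := fun t => Num.min (h1 t) (h2 t).

Variable (Y : normedModType R).

Definition dense_embedding (e : Y -> T -> R) :=
  (forall (a : R) (y y' : Y),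
      {ae mu, forall t, e (a *: y + y') t = a * e y t + e y' t}) /\
  (forall y, inZ (e y)) /\
  (exists C : R, forall y, (L2norm (e y) <= (C * `|y|)%:E)%E) /\
  (forall y, {ae mu, forall t, e y t = 0} -> y = 0) /\
  (forall z, inZ z -> forall eps : R, 0 < eps ->
      exists y, (L2norm (fun t => (e y t - z t)%R) < eps%:E)%E).

(* order on Y induced by Z: y <= 0 iff e(y) <= 0 a.e. *)
Definition leY0 (e : Y -> T -> R) (y : Y) := {ae mu, forall t, e y t <= 0}.

Variable (X : normedModType R).

Definition Y_convex (e : Y -> T -> R) (g : X -> Y) :=
  forall (x x' : X) (t : R), 0 <= t <= 1 ->
    leY0 e (g (t *: x + (1 - t) *: x') - (t *: g x + (1 - t) *: g x')).

Definition gplus (e : Y -> T -> R) (g : X -> Y) (x : X) : T -> R :=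
  posp (e (g x)).

Definition AugLag (e : Y -> T -> R) (f : X -> R) (g : X -> Y)
  (rho : R) (x : X) (lam : T -> R) : \bar R :=
  ((f x)%:E + (rho / 2)%:E *
     (L2norm (posp (fun t => (e (g x) t + lam t / rho)%R)) *
      L2norm (posp (fun t => (e (g x) t + lam t / rho)%R))))%E.

(* (x^k), (lambda^k), (w^k), (rho_k) are generated by the augmented Lagrangian
   algorithm, run without stopping, with inexact minimization in (S.2)
   controlled by eps_k decreasing to 0. *)
Definition ALM_run (e : Y -> T -> R) (f : X -> R) (g : X -> Y)
  (x : nat -> X) (lam w : nat -> T -> R) (rho eps : nat -> R)
  (wmax : T -> R) (gamma tau : R) :=
  inZ (lam 0%N) /\ 0 < rho 0%N /\ inZ wmax /\ {ae mu, forall t, 0 <= wmax t} /\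
  1 < gamma /\ 0 < tau < 1 /\
  (forall k, inZ (w k) /\ {ae mu, forall t, 0 <= w k t <= wmax t}) /\
  (forall k, eps k.+1 <= eps k) /\ eps @ \oo --> (0 : R) /\
  (forall k (z : X),
      (AugLag e f g (rho k) (x k.+1) (w k) <= AugLag e f g (rho k) z (w k) + (eps k)%:E)%E) /\
  (forall k, {ae mu, forall t,
      lam k.+1 t = posp (fun s => w k s + rho k * e (g (x k.+1)) s) t}) /\
  (forall k, rho k.+1 =
      if (k == 0)%N ||
         (L2norm (minf (fun t => (- e (g (x k.+1)) t)%R) (fun t => (w k t / rho k)%R))
          <= tau%:E * L2norm (minf (fun t => (- e (g (x k)) t)%R)
                                   (fun t => (w k.-1 t / rho k.-1)%R)))%E
      then rho k else gamma * rho k).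

Definition is_solution (e : Y -> T -> R) (f : X -> R) (g : X -> Y) (xbar : X) :=
  leY0 e (g xbar) /\ forall z, leY0 e (g z) -> f xbar <= f z.

End L2Setting.

(* Main.v *)
Require Import Defs.
From HB Require Import structures.
From mathcomp Require Import all_boot all_order all_algebra.
From mathcomp Require Import all_classical all_reals all_analysis.
From mathcomp Require Import measurable_realfun ring lra.
Import Order.TTheory GRing.Theory Num.Theory.
Import numFieldNormedType.Exports.
Local Open Scope classical_set_scope.
Local Open Scope ring_scope.

(* Every approximate minimizer sequence [u] of [f] for the constraint
   [|g_+| <= 0], i.e. [|g_+(u n)| -> 0] and [limsup f (u n) <= f xbar], converges
   strongly to the solution [xbar]: by convexity the midpoints of [u n] and
   [xbar] are asymptotically feasible, so [f] at the midpoints is asymptotically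
   at least [f xbar], and strong convexity bounds [|u n - xbar|^2]. The same
   midpoint argument makes minimizing sequences Cauchy, so existence follows from
   completeness, without weak compactness.

   To see that the iterates are such a sequence, set s = w/rho,
   p = |(g + s)_+|, q = |s| and a = |min(-g, s)|. Since s = (g + s)_+ + min(-g, s),
   q <= p + a; moreover |g_+| <= min(p, a), and comparing with the value at xbar
   gives f + rho/2 p^2 <= f xbar + rho/2 q^2 + eps, where rho q = |w| is bounded.
   If the penalty test eventually always succeeds then a -> 0 and
   rho/2 (q^2 - p^2) <= rho q a -> 0; otherwise rho -> oo, hence p -> 0 and
   rho/2 q^2 = (rho q)^2 / (2 rho) -> 0. *)

(** * Strongly convex, weakly lower semicontinuous functions and their constrained minimization *)

Lemma weakly_closed_closed {R : realType} {X : normedModType R} {A : set X} :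
  weakly_closed A -> closed A.
Proof.
move=> wA; rewrite -openC openE => x /wA [n [phi [dphi [delta delta0 sub]]]].
rewrite /interior; have : \forall y \near x, forall i, `|phi i y - phi i x| < delta.
  apply: filter_forall => i; have [_ /(_ x) cphi] := dphi i.
  by have /cvgrPdist_lt/(_ _ delta0) := cphi; apply: filterS => y; rewrite distrC.
by apply: filterS => y; exact: sub.
Qed.

Lemma weakly_lsc_closed {R : realType} {X : normedModType R} {F : X -> R} :
  weakly_lsc F -> forall c, closed [set x | F x <= c].
Proof. by move=> lF c; apply: weakly_closed_closed; exact: lF. Qed.

Lemma strongly_convex_midpoint {R : realType} {X : normedModType R} {F : X -> R} :
  strongly_convex F ->
  exists2 m, 0 < m & forall x y,
    F (2^-1 *: (x + y)) <= (F x + F y) / 2 - m * `|x - y| ^+ 2.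
Proof.
move=> [m m0 cF]; exists (m / 8) => [|x y]; first by rewrite divr_gt0.
have := cF x y 2^-1; rewrite (_ : 1 - 2^-1 = 2^-1 :> R); last by lra.
rewrite -scalerDr invr_ge0 ler0n/= invf_le1 ?ler1n ?ltr0n// => /(_ isT).
by move=> /le_trans; apply; rewrite le_eqVlt; apply/orP; left; apply/eqP; field.
Qed.

(** Lower semicontinuity at 0 bounds [F] below on a ball; outside it, strong convexity along rays
    from 0 forces quadratic growth, which beats the linear loss [|x| / s]. *)
Lemma strongly_convex_bounded_below {R : realType} {X : normedModType R}
    {F : X -> R} :
  strongly_convex F -> weakly_lsc F -> exists B, forall x, B <= F x.
Proof.
move=> [m m0 cF] lF.
have opn : open [set x | F 0 - 1 < F x].
  rewrite (_ : [set x | _] = ~` [set x | F x <= F 0 - 1]).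
    by rewrite openC; exact: weakly_lsc_closed.
  by apply/seteqP; split => x /=; rewrite ltNge => /negP.
have /nbhs_ballP[r /= r0 ballF] : nbhs 0 [set x | F 0 - 1 < F x].
  by apply: open_nbhs_nbhs; split => //=; rewrite ltrBlDr ltrDl.
have near0 x : `|x| < r -> F 0 - 1 < F x.
  by move=> xr; apply: ballF; rewrite -ball_normE /= sub0r normrN.
pose s := r / 2; have s0 : 0 < s by rewrite divr_gt0.
(* strong convexity on the segment [0, x], at its point of norm [s], where
   lower semicontinuity gives the bound [F 0 - 1] *)
have grow x : s <= `|x| -> F 0 - `|x| / s + m / 2 * (`|x| - s) * `|x| <= F x.
  move=> sx; have x0 : 0 < `|x| by exact: lt_le_trans sx.
  have t01 : 0 <= s / `|x| <= 1.
    by rewrite divr_ge0 ?(ltW s0)//= ler_pdivrMr// mul1r.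
  have := cF x 0 (s / `|x|) t01; rewrite scaler0 addr0 subr0.
  have /near0 : `|(s / `|x|) *: x| < r.
    rewrite normrZ normrM normfV normr_id (gtr0_norm s0) divfK ?gt_eqF//.
    by rewrite /s; lra.
  move=> /lt_le_trans h /h {h}/ltW h.
  rewrite -(ler_pM2l (_ : 0 < s / `|x|)) ?divr_gt0// -subr_ge0.
  rewrite -subr_ge0 in h; rewrite [leRHS](_ : _ = s / `|x| * F x +
    (1 - s / `|x|) * F 0 - m / 2 * (s / `|x|) * (1 - s / `|x|) * `|x| ^+ 2 -
    (F 0 - 1))//.
  by field; rewrite !gt_eqF.
(* Completing the square: the subtracted fraction is minus the minimum over [|x|] of the quadratic
   in [grow]. *)
exists (F 0 - 1 - (s^-1 + m / 2 * s) ^+ 2 / (2 * m)) => x.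
have sq : 0 <= (s^-1 + m / 2 * s) ^+ 2 / (2 * m).
  by rewrite divr_ge0 ?sqr_ge0// mulr_ge0// ltW.
have [xs|xs] := ltP `|x| s.
  have /near0 : `|x| < r by rewrite /s in xs; lra.
  by lra.
apply: le_trans (grow x xs).
have : 0 <= (m * `|x| - (s^-1 + m / 2 * s)) ^+ 2 / (2 * m).
  by rewrite divr_ge0 ?sqr_ge0// mulr_ge0// ltW.
suff -> : (m * `|x| - (s^-1 + m / 2 * s)) ^+ 2 / (2 * m) =
  (s^-1 + m / 2 * s) ^+ 2 / (2 * m) +
  (m / 2 * (`|x| - s) * `|x| - `|x| / s) by lra.
by field; rewrite !gt_eqF.
Qed.

(** [V] abstracts the violation [|g_+|]; its midpoint bound keeps midpoints of nearly feasible
    points nearly feasible. *)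
Lemma strongly_convex_well_posed {R : realType} {X : completeNormedModType R}
    {f V : X -> R} :
  strongly_convex f -> weakly_lsc f -> weakly_lsc V ->
  (forall x y, V (2^-1 *: (x + y)) <= Num.max (V x) (V y)) ->
  (exists z, V z <= 0) ->
  exists xbar, [/\ V xbar <= 0, forall z, V z <= 0 -> f xbar <= f z &
    forall u : nat -> X,
      (forall e, 0 < e -> \forall n \near \oo, V (u n) <= e /\ f (u n) <= f xbar + e) ->
      u @ \oo --> xbar].
Proof.
move=> cf lf lV midV [z0 Vz0].
have [m m0 midf] := strongly_convex_midpoint cf.
have [B Bf] := strongly_convex_bounded_below cf lf.
(* [sup S] is the limit, as delta tends to 0, of the infimum of [f] over [V <= delta]. This relaxed
   value is the right one for sequences that are only asymptotically feasible. *)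
pose S := [set c | exists2 delta, 0 < delta & forall y, V y <= delta -> c <= f y].
have supS : has_sup S.
  split; first by exists B, 1.
  by exists (f z0) => c [delta delta0 /(_ z0)]; apply; rewrite (le_trans Vz0)// ltW.
pose v := sup S.
have v_lb e : 0 < e -> exists2 delta, 0 < delta & forall y, V y <= delta -> v - e < f y.
  move=> e0; have [c [delta delta0 cf'] vc] := sup_adherent e0 supS.
  by exists delta => // y /cf'; exact: lt_le_trans.
have v_ub e delta : 0 < e -> 0 < delta -> exists2 y, V y <= delta & f y < v + e.
  move=> e0 delta0; apply: contrapT => no.
  suff : v + e <= v by rewrite gerDl leNgt e0.
  apply: ub_le_sup; first by case: supS.
  by exists delta => // y Vy; rewrite leNgt; apply/negP => fy; apply: no; exists y.
(* Both values are at most v + c and the midpoint value exceeds v - c, so m |y - y'|^2 < 2 c < m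
   e^2. *)
have close e : 0 < e -> exists2 delta, 0 < delta & forall y y',
    V y <= delta -> V y' <= delta -> f y <= v + delta -> f y' <= v + delta ->
    `|y - y'| < e.
  move=> e0; pose c := m * e ^+ 2 / 4.
  have c0 : 0 < c by rewrite divr_gt0// mulr_gt0// exprn_gt0.
  have [delta delta0 lb] := v_lb _ c0.
  exists (Num.min delta c) => [|y y' Vy Vy' fy fy']; first by rewrite lt_min delta0.
  have := midf y y'; have /lb : V (2^-1 *: (y + y')) <= delta.
    apply: le_trans (midV _ _) _; rewrite ge_max.
    by rewrite (le_trans Vy) ?(le_trans Vy') ?ge_min ?lexx.
  move: fy fy'; have : Num.min delta c <= c by rewrite ge_min lexx orbT.
  move=> ? ? ? ? ?; rewrite -ltr_sqr ?nnegrE ?(ltW e0)// -(ltr_pM2l m0).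
  have : m * e ^+ 2 = 4 * c by rewrite /c; field.
  by move=> ->; lra.
have inv0 n : 0 < n.+1%:R^-1 :> R by rewrite invr_gt0.
have /choice[y hy] n : exists y, V y <= n.+1%:R^-1 /\ f y < v + n.+1%:R^-1.
  by have [y Vy fy] := v_ub _ _ (inv0 n) (inv0 n); exists y.
have y_near e : 0 < e -> \forall n \near \oo, V (y n) <= e /\ f (y n) <= v + e.
  move=> e0; have [N _ hN] := near_infty_natSinv_lt (PosNum e0).
  exists N => // n /hN/= /ltW ne; have [Vy /ltW fy] := hy n.
  by rewrite (le_trans Vy ne) (le_trans fy)// lerD2l.
have /cauchy_cvgP/cvg_ex[xbar y_cvg] : cauchy (y @ \oo).
  apply: cauchy_exP => e e0; have [delta delta0 cl] := close e e0.
  have [N _ yN] := y_near _ delta0; exists (y N); exists N => // n /= Nn.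
  rewrite -ball_normE /=; have [VN fN] := yN _ (leqnn N).
  by have [Vn fn] := yN _ Nn; exact: cl.
have Vxbar : V xbar <= 0.
  apply/ler_addgt0Pl => e e0; rewrite addr0.
  apply: (closed_cvg [set z | V z <= e]) y_cvg; first exact: weakly_lsc_closed.
  by apply: filterS (y_near _ e0) => n [].
have fxbar : f xbar <= v.
  apply/ler_addgt0Pr => e e0.
  apply: (closed_cvg [set z | f z <= v + e]) y_cvg; first exact: weakly_lsc_closed.
  by apply: filterS (y_near _ e0) => n [].
(* A feasible [z] lies in every set [V <= delta], so v <= f z. With [fxbar], the relaxed value is
   the true minimum, and [close] can compare [u n] with [xbar] itself. *)
exists xbar; split => // [z Vz|u u_near].
  apply/ler_addgt0Pr => e e0; have [delta delta0 lb] := v_lb _ e0.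
  have /lb : V z <= delta by rewrite (le_trans Vz)// ltW.
  by rewrite ltrBlDr => /ltW; exact: le_trans.
apply/cvgrPdist_lt => e e0; have [delta delta0 cl] := close e e0.
apply: filterS (u_near _ delta0) => n [Vn fn]; apply: cl => //.
- by rewrite (le_trans Vxbar)// ltW.
- by rewrite (le_trans fxbar)// lerDl ltW.
- by rewrite (le_trans fn)// lerD2r.
Qed.

(** * Penalty estimates on real sequences *)

(** Index [k] refers to the iterate x^{k+1}: [F] and [V] are [f] and [|g_+|] there, [Fb] is the
    optimal value, [B] a lower bound of [f] and [W] the norm of [wmax]. *)
Lemma alm_estimates {R : realType} {F p q a V rho eps : nat -> R}
    {Fb B W gamma tau : R} :
  0 < rho 0%N -> 1 < gamma -> 0 < tau < 1 -> eps @ \oo --> (0 : R) ->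
  (forall k, 0 <= p k) -> (forall k, 0 <= q k) -> (forall k, 0 <= a k) ->
  (forall k, q k <= p k + a k) -> (forall k, rho k * q k <= W) ->
  (forall k, V k <= p k) -> (forall k, V k <= a k) ->
  (forall k, B <= F k) ->
  (forall k, F k + rho k / 2 * p k ^+ 2 <= Fb + rho k / 2 * q k ^+ 2 + eps k) ->
  (forall k, rho k.+1 = if (k == 0)%N || (a k <= tau * a k.-1)
                        then rho k else gamma * rho k) ->
  forall e, 0 < e -> \forall k \near \oo, V k <= e /\ F k <= Fb + e.
Proof.
move=> rho0 gamma1 /andP[tau0 tau1] eps0 p0 q0 a0 qpa qW Vp Va BF desc upd e e0.
have gamma0 : 0 < gamma by exact: lt_trans gamma1.
have rhoS k : rho k.+1 = rho k \/ rho k.+1 = gamma * rho k.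
  by rewrite upd; case: ifP; [left|right].
have rho_gt0 k : 0 < rho k.
  by elim: k => // k IH; case: (rhoS k) => ->; rewrite ?mulr_gt0.
have rho_le k : rho k <= rho k.+1.
  by case: (rhoS k) => ->//; rewrite ler_peMl// ltW.
have rho_homo : {homo rho : m n / (m <= n)%N >-> m <= n}.
  exact: homo_leq (@lexx _ _) (@le_trans _ _) rho_le.
have W0 : 0 <= W by apply: le_trans (qW 0%N); rewrite mulr_ge0// ltW.
have small d : 0 < d -> \forall k \near \oo, eps k <= d.
  move=> d0; move/cvgr_le : eps0; exact.
(* Either the penalty test succeeds from some index on and [a] decays geometrically, or it fails
   infinitely often and [rho] is unbounded. *)
have [[K stat]|infinite] :=
    pselect (exists K, forall k, (K <= k)%N -> a k.+1 <= tau * a k).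
  have a_geo n : a (K + n)%N <= tau ^+ n * a K.
    elim: n => [|n IH]; first by rewrite addn0 expr0 mul1r.
    rewrite addnS exprS -mulrA (le_trans (stat _ (leq_addr _ _)))//.
    by rewrite ler_pM2l.
  have acvg d : 0 < d -> \forall k \near \oo, a k <= d.
    move=> d0; have : (fun n => tau ^+ n * a K) @ \oo --> 0 * a K.
      by apply: cvgMl; apply: cvg_expr; rewrite gtr0_norm.
    rewrite mul0r => /cvgr_le/(_ _ d0) [N _ aN].
    exists (K + N)%N => // k /= KNk.
    have Kk : (K <= k)%N by rewrite (leq_trans _ KNk)// leq_addr.
    by rewrite -(subnKC Kk) (le_trans (a_geo _))// aN//= leq_subRL.
  (* [W + 1] keeps the denominator positive when [W = 0]. *)
  have d0 : 0 < e / (2 * (W + 1)) by rewrite divr_gt0// mulr_gt0// ltr_wpDl.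
  have e2 : 0 < e / 2 by rewrite divr_gt0.
  near=> k; split; first by rewrite (le_trans (Va k))//; near: k; exact: acvg.
  have ak : a k <= e / (2 * (W + 1)) by near: k; exact: acvg.
  have epsk : eps k <= e / 2 by near: k; exact: small.
  (* q^2 - p^2 <= 2 a q because q <= p + a *)
  have qp : rho k / 2 * q k ^+ 2 <= rho k / 2 * p k ^+ 2 + rho k * q k * a k.
    have -> : rho k * q k * a k = rho k / 2 * (2 * q k * a k) by field.
    rewrite -mulrDr ler_pM2l ?divr_gt0//.
    have [qp|pq] := leP (q k) (p k).
      by rewrite ler_wpDr ?ler_sqr ?nnegrE// !mulr_ge0.
    (* The two products give q^2 - p^2 <= a (q + p) <= 2 a q. *)
    have : 0 <= (p k + a k - q k) * (q k + p k).
      by apply: mulr_ge0; [rewrite subr_ge0|exact: addr_ge0].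
    have : 0 <= a k * (q k - p k) by rewrite mulr_ge0// subr_ge0 ltW.
    by move=> + + ; lra.
  have Wa : rho k * q k * a k <= e / 2.
    apply: (@le_trans _ _ ((W + 1) * (e / (2 * (W + 1))))).
      apply: ler_pM => //; first by rewrite mulr_ge0// ltW.
      by rewrite (le_trans (qW k))// lerDl.
    rewrite le_eqVlt; apply/orP; left; apply/eqP; field.
    by rewrite gt_eqF// ltr_wpDl.
  by have := desc k; lra.
have rho_big M : \forall k \near \oo, M <= rho k.
  have geo n : exists k, gamma ^+ n * rho 0%N <= rho k.
    elim: n => [|n [k hk]]; first by exists 0%N; rewrite expr0 mul1r.
    have [l [kl al]] : exists l, (k <= l)%N /\ ~~ (a l.+1 <= tau * a l).
      apply: contrapT => hn; apply: infinite; exists k => l kl.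
      by apply: contrapT => /negP al; apply: hn; exists l.
    (* The test comparing [a l.+1] with [a l] is made at step [l.+1] and determines [rho l.+2]. *)
    exists l.+2; rewrite upd/= (negbTE al) exprS -mulrA ler_pM2l//.
    by rewrite (le_trans hk)// rho_homo// leqW.
  have ginv : `|gamma^-1| < 1 by rewrite gtr0_norm ?invr_gt0// invf_lt1.
  have M1 : 0 < rho 0%N / (`|M| + 1) by rewrite divr_gt0// ltr_wpDl.
  have /cvgr_le/(_ _ M1) [N _ /(_ N)/= /(_ (leqnn N))] := cvg_expr ginv.
  rewrite exprVn ler_pdivlMr ?ltr_wpDl// mulrC ler_pdivrMr ?exprn_gt0// => hN.
  have [k hk] := geo N; exists k => // l /= kl.
  apply: le_trans (rho_homo _ _ kl); rewrite (le_trans _ hk)// mulrC.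
  by rewrite (le_trans _ hN)// (le_trans (ler_norm M))// lerDl.
have Wq k : rho k / 2 * q k ^+ 2 <= W ^+ 2 / (2 * rho k).
  rewrite ler_pdivlMr ?mulr_gt0//.
  have -> : rho k / 2 * q k ^+ 2 * (2 * rho k) = (rho k * q k) ^+ 2 by field.
  by rewrite ler_sqr ?nnegrE// mulr_ge0// ltW.
have Wsmall d : 0 < d -> \forall k \near \oo, W ^+ 2 / (2 * rho k) <= d.
  move=> d0; have := rho_big (W ^+ 2 / (2 * d)); apply: filterS => k.
  rewrite ler_pdivrMr ?mulr_gt0// => h; rewrite ler_pdivrMr ?mulr_gt0//.
  by rewrite (le_trans h)// le_eqVlt; apply/orP; left; apply/eqP; ring.
have e2 : 0 < e / 2 by rewrite divr_gt0.
near=> k.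
have epsk : eps k <= e / 2 by near: k; exact: small.
have Wk : W ^+ 2 / (2 * rho k) <= e / 2 by near: k; exact: Wsmall.
have pp : 0 <= rho k / 2 * p k ^+ 2.
  by rewrite mulr_ge0 ?sqr_ge0// divr_ge0// ltW.
split; last by have := desc k; have := Wq k; lra.
rewrite (le_trans (Vp k))//.
rewrite -ler_sqr ?nnegrE ?(ltW e0)//.
(* Since rho / 2 * p^2 <= Fb - B + e ([hp]), this threshold yields p^2 <= e^2. *)
have rk : 2 * (Fb - B + e) / e ^+ 2 <= rho k by near: k; exact: rho_big.
rewrite ler_pdivrMr ?exprn_gt0// in rk.
have hp : rho k / 2 * p k ^+ 2 <= Fb - B + e.
  by have := desc k; have := Wq k; have := BF k; lra.
rewrite -(ler_pM2l (rho_gt0 k)) (le_trans _ rk)//; lra.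
Unshelve. all: by end_near. Qed.

(** * The real-valued L2 norm *)

(** [fine] sends [+oo] to 0, so this is the L2 norm only for functions in [inZ]. *)
Definition normL2 {R : realType} {d : measure_display} {T : measurableType d}
  (mu : {measure set T -> \bar R}) (h : T -> R) : R := fine (L2norm mu h).

Section L2.
Context {R : realType} {d : measure_display} {T : measurableType d}.
Context {mu : {measure set T -> \bar R}}.
Implicit Types h : T -> R.

Lemma posp_ge0 h t : 0 <= posp h t.
Proof. by rewrite le_max lexx orbT. Qed.

Lemma ger_posp h t c :
  0 <= c -> h t <= c -> posp h t <= c.
Proof. by move=> c0 hc; rewrite ge_max hc. Qed.

Lemma ler_posp h t : h t <= posp h t.
Proof. by rewrite le_max lexx. Qed.

Lemma L2norm_le {h1 h2} :
  measurable_fun setT h1 -> measurable_fun setT h2 ->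
  {ae mu, forall t, `|h1 t| <= `|h2 t|} -> (L2norm mu h1 <= L2norm mu h2)%E.
Proof.
move=> mh1 mh2 h12; rewrite /L2norm unlock.
have mpow h : measurable_fun setT h ->
    measurable_fun setT (fun t => (`|h t| `^ 2)%:E).
  move=> mh; apply/measurable_EFinP.
  by apply: (measurableT_comp (measurable_powR _)); exact: measurableT_comp.
have pow0 h t : (0 <= (`|h t| `^ 2)%:E)%E by rewrite lee_fin powR_ge0.
apply: gt0_ler_poweR => /=; rewrite ?invr_ge0// ?in_itv/= ?leey ?andbT.
- by apply: integral_ge0 => t _; exact: pow0.
- by apply: integral_ge0 => t _; exact: pow0.
apply: ae_ge0_le_integral => //; [exact: mpow|exact: mpow|].
apply: filterS h12 => t h12 _.
by rewrite lee_fin ge0_ler_powR// nnegrE.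
Qed.

Lemma normL2K {h} : inZ mu h -> (normL2 mu h)%:E = L2norm mu h.
Proof. by move=> [_ hoo]; rewrite fineK// ge0_fin_numE// Lnorm_ge0. Qed.

Lemma normL2_ge0 h : 0 <= normL2 mu h.
Proof. by rewrite fine_ge0// Lnorm_ge0. Qed.

Lemma normL2_le {h1 h2} : inZ mu h1 -> inZ mu h2 ->
  {ae mu, forall t, `|h1 t| <= `|h2 t|} -> normL2 mu h1 <= normL2 mu h2.
Proof.
move=> Z1 Z2 h12; rewrite -lee_fin !normL2K//.
by case: Z1 Z2 => ? _ [? _]; exact: L2norm_le.
Qed.

Lemma inZ_le {h1 h2} : measurable_fun setT h1 -> inZ mu h2 ->
  {ae mu, forall t, `|h1 t| <= `|h2 t|} -> inZ mu h1.
Proof.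
by move=> m1 [m2 fin2] h12; split => //; apply: le_lt_trans fin2; exact: L2norm_le.
Qed.

Lemma inZD {h1 h2} : inZ mu h1 -> inZ mu h2 -> inZ mu (fun t => h1 t + h2 t).
Proof.
move=> [m1 fin1] [m2 fin2]; split; first exact: measurable_funD.
have := minkowski_EFin mu m1 m2 (ler1n R 2) => /le_lt_trans; apply.
exact: lte_add_pinfty.
Qed.

Lemma normL2D {h1 h2} : inZ mu h1 -> inZ mu h2 ->
  normL2 mu (fun t => h1 t + h2 t) <= normL2 mu h1 + normL2 mu h2.
Proof.
move=> Z1 Z2; rewrite -lee_fin EFinD !normL2K//; last exact: inZD.
by case: Z1 Z2 => [m1 _] [m2 _]; apply: minkowski_EFin => //; rewrite ler1n.
Qed.

Lemma L2normZ a {h} : inZ mu h ->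
  (L2norm mu (fun t => a * h t)%R = `|a|%:E * L2norm mu h)%E.
Proof.
move=> [mh hoo]; have p1 : (1 <= 2%:E :> \bar R)%E by rewrite lee_fin ler1n.
have hL : h \in Lfun mu 2%:E by rewrite inE; apply/andP; split; rewrite inE.
exact: (LnormZ (Lfun_Sub p1 hL) a).
Qed.

Lemma inZZ a {h} : inZ mu h -> inZ mu (fun t => a * h t).
Proof.
move=> Zh; have [mh hoo] := Zh; split; first exact: measurable_funM.
by rewrite L2normZ// -normL2K// -EFinM ltry.
Qed.

Lemma normL2Z a {h} : inZ mu h -> normL2 mu (fun t => a * h t) = `|a| * normL2 mu h.
Proof.
move=> Zh; apply: EFin_inj.
by rewrite EFinM !normL2K ?L2normZ//; exact: inZZ.
Qed.

Lemma inZ_posp {h} : inZ mu h -> inZ mu (posp h).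
Proof.
move=> Zh; apply: (inZ_le _ Zh).
  by apply: measurable_maxr => //; case: Zh.
by apply: aeW => t; rewrite (ger0_norm (posp_ge0 _ _)) ger_posp ?ler_norm.
Qed.

Lemma inZ_minf {h1 h2} : inZ mu h1 -> inZ mu h2 -> inZ mu (minf h1 h2).
Proof.
move=> Z1 Z2; have Zn h : inZ mu h -> inZ mu (fun t => `|h t|).
  move=> Zh; apply: (inZ_le _ Zh); first by apply: measurableT_comp => //; case: Zh.
  by apply: aeW => t; rewrite normr_id.
apply: (inZ_le _ (inZD (Zn _ Z1) (Zn _ Z2))).
  by apply: measurable_minr; [case: Z1|case: Z2].
apply: aeW => t; rewrite /minf [leRHS]ger0_norm ?addr_ge0//.
by case: (leP (h1 t) (h2 t)) => _; rewrite ?lerDl ?lerDr.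
Qed.

End L2.

(** * The constraint violation [|g_+|] and the augmented Lagrangian *)

Section constraint.
Context {R : realType} {X Y : completeNormedModType R}.
Context {d : measure_display} {T : measurableType d}.
Context {mu : {measure set T -> \bar R}} {e : Y -> T -> R} {g : X -> Y}.
Hypothesis emb : dense_embedding mu e.

Let eZ y : inZ mu (e y).
Proof. by case: emb => _ []. Qed.

Lemma inZ_gplus z : inZ mu (gplus e g z).
Proof. exact: inZ_posp. Qed.

Lemma leY0P z : leY0 mu e (g z) <-> normL2 mu (gplus e g z) <= 0.
Proof.
split=> [gz0|].
  (* The zero function is written as a multiple of [e (g z)] so that homogeneity gives its norm. *)
  apply: (@le_trans _ _ (normL2 mu (fun t => 0 * e (g z) t))).
    apply: normL2_le (inZ_gplus z) (inZZ _ (eZ _)) _.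
    apply: filterS gz0 => t gzt.
    by rewrite /gplus /posp mul0r (max_idPr gzt).
  by rewrite normL2Z// normr0 mul0r.
move=> V0; have : L2norm mu (gplus e g z) = 0.
  by rewrite -(normL2K (inZ_gplus z)); congr EFin; apply/eqP;
    rewrite eq_le V0 normL2_ge0.
have mV : measurable_fun setT (EFin \o gplus e g z).
  by apply/measurable_EFinP; case: (inZ_gplus z).
have lt02 : (0 < 2%:E :> \bar R)%E by rewrite lte_fin.
move=> N0; apply: filterS (Lnorm_eq0_eq0 mV lt02 N0) => t Nt.
have V0t : gplus e g z t = 0 := EFin_inj (Nt I).
by rewrite -[leRHS]V0t /gplus /posp le_max lexx.
Qed.

Lemma ae_convex_midpoint : Y_convex mu e g -> forall x y,
  {ae mu, forall t, e (g (2^-1 *: (x + y))) t <=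
    2^-1 * e (g x) t + 2^-1 * e (g y) t}.
Proof.
move=> cg x y; have [elin _] := emb.
have := cg x y 2^-1; rewrite (_ : 1 - 2^-1 = 2^-1 :> R); last by lra.
rewrite invr_ge0 ler0n/= invf_le1 ?ler1n ?ltr0n// -scalerDr => /(_ isT).
set m := g _; set v := 2^-1 *: g x + _ => cmid.
(* [e] is linear only almost everywhere for each choice of arguments, so the finitely many instances
   used are intersected; [e0] yields e 0 = 0 a.e. *)
have e0 := elin 1 0 0; have ey := elin 2^-1 (g y) 0.
have ev := elin 2^-1 (g x) (2^-1 *: g y); have ed := elin (-1) v m.
rewrite !addr0 in e0 ey; rewrite scaler0 in e0.
rewrite scaleN1r (addrC (- v)) in ed; rewrite -/v in ev.
apply: filterS2 (filterI e0 ey) (filterI (filterI ev ed) cmid).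
by move=> t [h0 hy] [[hv hd] hc]; lra.
Qed.

(** The positive part is monotone and sublinear, so g_+ at the midpoint is a.e. at most the average
    of the two g_+; the triangle inequality bounds its norm by the average of the norms. *)
Lemma gplus_midpoint : Y_convex mu e g -> forall x y,
  normL2 mu (gplus e g (2^-1 *: (x + y))) <=
  Num.max (normL2 mu (gplus e g x)) (normL2 mu (gplus e g y)).
Proof.
move=> cg x y; set Vx := normL2 mu (gplus e g x); set Vy := normL2 mu (gplus e g y).
have Zx := inZZ 2^-1 (inZ_gplus x); have Zy := inZZ 2^-1 (inZ_gplus y).
apply: (@le_trans _ _ (2^-1 * Vx + 2^-1 * Vy)).
  apply: (@le_trans _ _ (normL2 mu (fun t => 2^-1 * gplus e g x t +
                                             2^-1 * gplus e g y t))).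
    apply: normL2_le (inZ_gplus _) (inZD Zx Zy) _.
    apply: filterS (ae_convex_midpoint cg x y) => t.
    have sum0 : 0 <= 2^-1 * gplus e g x t + 2^-1 * gplus e g y t.
      by rewrite addr_ge0// mulr_ge0// posp_ge0.
    rewrite (ger0_norm (posp_ge0 _ _)) (ger0_norm sum0) => h; apply: ger_posp => //.
    by rewrite (le_trans h)// lerD// ler_pM2l ?invr_gt0// ler_posp.
  apply: (le_trans (normL2D Zx Zy)).
  by rewrite !normL2Z ?ger0_norm ?invr_ge0//; exact: inZ_gplus.
by rewrite le_max; case: (leP Vx Vy) => h; apply/orP; [right|left]; lra.
Qed.

Lemma AugLagE (f : X -> R) r z l : inZ mu l ->
  AugLag mu e f g r z l =
  (f z + r / 2 * normL2 mu (posp (fun t => e (g z) t + l t / r)) ^+ 2)%:E.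
Proof.
move=> Zl; have Zp : inZ mu (posp (fun t => e (g z) t + l t / r)).
  by apply: inZ_posp; apply: inZD => //; under eq_fun do rewrite mulrC; exact: inZZ.
by rewrite /AugLag -(normL2K Zp) -!EFinM -EFinD -expr2.
Qed.

End constraint.

(** * Convergence of the iterates *)

Theorem theorem4p3 (R : realType) (X Y : completeNormedModType R)
  (d : measure_display) (T : measurableType d) (mu : {measure set T -> \bar R})
  (e : Y -> T -> R) (f : X -> R) (g : X -> Y)
  (x : nat -> X) (lam w : nat -> T -> R) (rho eps : nat -> R)
  (wmax : T -> R) (gamma tau : R) :
  reflexive_space X ->
  dense_embedding mu e ->
  weakly_lsc f ->
  weakly_lsc (fun z : X => fine (L2norm mu (gplus e g z))) ->
  Y_convex mu e g ->
  strongly_convex f ->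
  (exists z : X, leY0 mu e (g z)) ->
  ALM_run mu e f g x lam w rho eps wmax gamma tau ->
  exists xbar : X,
    is_solution mu e f g xbar /\
    (forall z : X, is_solution mu e f g z -> z = xbar) /\
    x @ \oo --> xbar.
Proof.
move=> _ emb lf lV cg cf [z0 z0_feas].
move=> [_ [rho0 [Zwmax [wmax0 [gamma1 [tau01 [w_bd [_ [eps0 [xmin [_ upd]]]]]]]]]]].
pose V z := normL2 mu (gplus e g z).
have [xbar [Vxbar xbar_min xbar_cvg]] : exists xbar, [/\ V xbar <= 0,
    forall z, V z <= 0 -> f xbar <= f z & forall u : nat -> X,
      (forall c, 0 < c -> \forall n \near \oo, V (u n) <= c /\ f (u n) <= f xbar + c) ->
      u @ \oo --> xbar].
  apply: strongly_convex_well_posed => //; first exact: gplus_midpoint.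
  by exists z0; exact/(leY0P emb).
have xbar_feas : leY0 mu e (g xbar) by exact/(leY0P emb).
exists xbar; split; first by split=> // z /(leY0P emb); exact: xbar_min.
split.
  (* Uniqueness: the constant sequence at another solution is a minimizing sequence, so it converges
     to [xbar]. *)
  move=> z [/(leY0P emb) Vz zmin]; have : (fun=> z) @ \oo --> xbar.
    apply: xbar_cvg => c c0; apply: nearW => _; split.
      by rewrite (le_trans Vz)// ltW.
    by rewrite (le_trans (zmin _ xbar_feas))// lerDl ltW.
  by move=> zx; exact: (cvg_unique (@norm_hausdorff _ _) (cvg_cst z) zx).
have [B Bf] := strongly_convex_bounded_below cf lf.
have Zw k : inZ mu (w k) by case: (w_bd k).
have Ze y : inZ mu (e y) by case: emb => _ [].
have rho_gt0 k : 0 < rho k.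
  elim: k => // k IH; rewrite upd; case: ifP => // _.
  by rewrite mulr_gt0// (lt_trans ltr01).
pose s k t := w k t / rho k.
have sE k : s k = (fun t => (rho k)^-1 * w k t) by apply/funext => t; exact: mulrC.
have Zs k : inZ mu (s k) by rewrite sE; exact: inZZ.
have s_ge0 k : {ae mu, forall t, 0 <= s k t}.
  have [_] := w_bd k; apply: filterS => t /andP[wt _].
  by rewrite divr_ge0// ltW.
pose h k t := e (g (x k.+1)) t + s k t.
have Zh k : inZ mu (posp (h k)) by apply: inZ_posp; exact: inZD.
pose mn k := minf (fun t => - e (g (x k.+1)) t) (s k).
have Zmn k : inZ mu (mn k).
  apply: inZ_minf => //; have := inZZ (-1) (Ze (g (x k.+1))).
  by under eq_fun do rewrite mulN1r.
rewrite -cvg_shiftS; apply: xbar_cvg.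
apply: (@alm_estimates _ (fun k => f (x k.+1)) (fun k => normL2 mu (posp (h k)))
  (fun k => normL2 mu (s k)) (fun k => normL2 mu (mn k)) (fun k => V (x k.+1))
  rho eps (f xbar) B (normL2 mu wmax) gamma tau) => //.
- by move=> k; exact: normL2_ge0.
- by move=> k; exact: normL2_ge0.
- by move=> k; exact: normL2_ge0.
- move=> k; rewrite [X in normL2 mu X <= _](_ : _ = fun t => posp (h k) t + mn k t).
    exact: normL2D.
  apply/funext => t; rewrite /posp /mn /minf /h.
  by case: (leP (_ + _) 0); case: (leP (- _) (s k t)) => ? ?; lra.
- move=> k; rewrite sE normL2Z// gtr0_norm ?invr_gt0// mulVKf ?gt_eqF//.
  apply: normL2_le => //; have [_] := w_bd k.
  apply: filterS => t /andP[w0 wm]; rewrite !ger0_norm//.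
  exact: le_trans wm.
- move=> k; apply: normL2_le => //; first exact: inZ_gplus.
  apply: filterS (s_ge0 k) => t st; rewrite !(ger0_norm (posp_ge0 _ _)).
  apply: ger_posp (posp_ge0 _ _) _; apply: le_trans (ler_posp _ _).
  by rewrite lerDl.
(* Where g > 0, s >= 0 gives min(-g, s) = -g, of absolute value g_+; elsewhere g_+ = 0. *)
- move=> k; apply: normL2_le => //; first exact: inZ_gplus.
  apply: filterS (s_ge0 k) => t st; rewrite (ger0_norm (posp_ge0 _ _)) /mn /minf.
  apply: ger_posp => //; have [gt0|gt0] := leP (e (g (x k.+1)) t) 0.
    exact: le_trans (normr_ge0 _).
  rewrite (min_idPl _) ?normrN ?ler_norm// (le_trans _ st)// oppr_le0.
  exact: ltW.
(* Feasibility of [xbar] and s >= 0 give (g(xbar) + s)_+ <= s a.e. *)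
- move=> k; have := xmin k xbar; rewrite !AugLagE// -EFinD lee_fin => /le_trans.
  apply; rewrite lerD2r lerD2l ler_pM2l ?divr_gt0// ler_sqr ?nnegrE ?normL2_ge0//.
  apply: normL2_le => //; first exact: inZ_posp (inZD (Ze _) (Zs k)).
  apply: filterS2 xbar_feas (s_ge0 k) => t et st.
  rewrite (ger0_norm (posp_ge0 _ _)) (ger0_norm st); apply: ger_posp => //.
  by rewrite gerDr.
(* At [k = 0] the first disjunct decides; later all norms are finite, so the extended-real test is
   the real one. *)
- case=> [|k]; first by rewrite upd.
  by rewrite upd /= -(normL2K (Zmn k.+1)) -(normL2K (Zmn k)) -EFinM lee_fin.
Qed.
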